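(* Put $h_{\mathrm{TL}}=e^{-\pi\mathrm i/3}$ and $\widetilde R_1=-\mathrm iR_1$. Then $$(\widetilde R_1+I)(\widetilde R_1-h_{\mathrm{TL}}I)=0,\qquad\eta(\widetilde R_1)=\frac13,$$ and the corresponding Hecke representation (that is, $\rho_n:H_n(h_{\mathrm{TL}})\to\mathrm{End}(V^{\otimes n})$, $g_i\mapsto\widetilde R_{1,i}$, for every $n\ge2$) factors through the Temperley--Lieb quotient $\mathrm{TL}_n(h_{\mathrm{TL}})$. Thus $R_1$ gives the qutrit Gaussian Temperley--Lieb parameter appearing in the Rowell--Wang localization.
   Context: Let $\omega=e^{2\pi\mathrm i/3}$, $V=\mathbb C^3$ with orthonormal basis $e_j$, $j\in\mathbb F_3$, $Xe_j=e_{j+1}$, $Ze_j=\omega^je_j$, $U=Z\otimes X$ on $V\otimes V$, and define the unitary Yang--Baxter operator $$R_1=(Z\otimes Z)\cdot\frac1{\sqrt3}\bigl(I+\omega^2(U+U^2)\bigr)\cdot(Z\otimes Z)^{-1}.$$ $\widetilde R_{1,i}=I^{\otimes(i-1)}\otimes\widetilde R_1\otimes I^{\otimes(n-i-1)}$, $1\le i<n$, is the local copy on $V^{\otimes n}$. For a unitary Yang--Baxter operator $R$ on $V\otimes V$ with two distinct eigenvalues and $(R+I)(R-qI)=0$, $q\neq-1$, the spectral density is $\eta(R)=\mathrm{rank}(p)/(\dim V)^2$ with $p=\frac{qI-R}{q+1}$. $H_n(q)$ is the Hecke algebra with generators $g_1,\dots,g_{n-1}$, the braid relations and $(g_i+1)(g_i-q)=0$;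 $\mathrm{TL}_n(q)$ is its quotient by the relations $e_ie_je_i=\frac{q}{(1+q)^2}e_i$ for $|i-j|=1$, where $e_i=\frac{q-g_i}{q+1}$. ''The Rowell--Wang localization'' refers to E. C. Rowell and Z. Wang, ''Localization of unitary braid group representations'', Comm. Math. Phys. 311 (2012), 595--615; localizing a tower of braid group representations means realizing it by the local copies of a single Yang--Baxter operator on tensor powers of a fixed space. ''Qutrit'' refers to local dimension $3$, and ''Gaussian'' to operators whose coefficients in powers of a Pauli operator are quadratic phases, as for $I+\omega^2(U+U^2)=\sum_{a\in\mathbb F_3}\omega^{2a^2}U^a$. *)

(* Defs.v *)
(* Operators on C^m are matrices acting on column vectors, and the Kronecker
   product *t realises the tensor product. *)
From HB Require Import structures.
From mathcomp Require Import all_boot all_order all_algebra.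
From mathcomp Require Import boolp classical_sets reals trigo.
From mathcomp Require Import finmap.
From mathcomp.real_closed Require Import complex mxtens.
From mathcomp.multinomials Require Import monalg.

Set Implicit Arguments.
Unset Strict Implicit.
Unset Printing Implicit Defensive.

Import GRing.Theory Num.Theory.
Local Open Scope ring_scope.
Local Open Scope quotient_scope.

Section QuotientAlgebra.
Variables (K : fieldType) (A : algType K) (S : set A).

Inductive ideal_gen : A -> Prop :=
| IdealGen s of S s : ideal_gen s
| Ideal0 : ideal_gen 0
| IdealD x y of ideal_gen x & ideal_gen y : ideal_gen (x + y)
| IdealMl a x of ideal_gen x : ideal_gen (a * x)
| IdealMr x a of ideal_gen x : ideal_gen (x * a).

Lemma idealN x : ideal_gen x -> ideal_gen (- x).
Proof. by move=> Ix; rewrite -mulN1r; apply: IdealMl. Qed.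

Definition qalg_equiv : rel A := fun x y => `[< ideal_gen (x - y) >].

Lemma qalg_equiv_refl : reflexive qalg_equiv.
Proof. by move=> x; apply/asboolP; rewrite subrr; apply: Ideal0. Qed.

Lemma qalg_equiv_sym : symmetric qalg_equiv.
Proof.
by move=> x y; apply/asboolP/asboolP => /idealN; rewrite opprB.
Qed.

Lemma qalg_equiv_trans : transitive qalg_equiv.
Proof.
move=> y x z /asboolP Ixy /asboolP Iyz; apply/asboolP.
by rewrite -(subrKA y); apply: IdealD.
Qed.

Canonical qalg_equiv_rel :=
  EquivRel qalg_equiv qalg_equiv_refl qalg_equiv_sym qalg_equiv_trans.

Definition qalg := {eq_quot qalg_equiv}.
HB.instance Definition _ := Choice.on qalg.
HB.instance Definition _ := EqQuotient.on qalg.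

Lemma qalg_piE x y : (\pi_qalg x = \pi_qalg y) <-> ideal_gen (x - y).
Proof.
split=> [/eqquotP|Ixy]; first by move/asboolP.
by apply/eqquotP/asboolP.
Qed.

Let qpi : A -> qalg := \pi_qalg.
Let qadd (x y : qalg) : qalg := qpi (repr x + repr y).
Let qopp (x : qalg) : qalg := qpi (- repr x).
Let qmul (x y : qalg) : qalg := qpi (repr x * repr y).
Let qscale (a : K) (x : qalg) : qalg := qpi (a *: repr x).

Let reprI x : ideal_gen (repr (qpi x) - x).
Proof. by apply/qalg_piE; rewrite reprK. Qed.

Let qaddE x y : qadd (qpi x) (qpi y) = qpi (x + y).
Proof. by apply/qalg_piE; rewrite opprD addrACA; apply: IdealD. Qed.

Let qoppE x : qopp (qpi x) = qpi (- x).
Proof. by apply/qalg_piE; rewrite -opprD; apply: idealN. Qed.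

Let qmulE x y : qmul (qpi x) (qpi y) = qpi (x * y).
Proof.
apply/qalg_piE; set x' := repr _; set y' := repr _.
rewrite -(subrKA (x' * y)) -mulrBr -mulrBl.
by apply: IdealD; [apply: IdealMl | apply: IdealMr]; apply: reprI.
Qed.

Let qscaleE a x : qscale a (qpi x) = qpi (a *: x).
Proof.
apply/qalg_piE; rewrite -scalerBr -[X in a *: X]mul1r scalerAl.
exact: IdealMl.
Qed.

Let qE := (qaddE, qoppE, qmulE, qscaleE).
Let qind (P : qalg -> Prop) : (forall x, P (qpi x)) -> forall x, P x.
Proof. by move=> Pp x; rewrite -[x]reprK. Qed.

Let qaddA : associative qadd.
Proof. by move=> x y z; elim/qind: x => x; elim/qind: y => y; elim/qind: z => z; rewrite !qE addrA. Qed.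
Let qaddC : commutative qadd.
Proof. by move=> x y; elim/qind: x => x; elim/qind: y => y; rewrite !qE addrC. Qed.
Let qadd0 : left_id (qpi 0) qadd.
Proof. by move=> x; elim/qind: x => x; rewrite !qE add0r. Qed.
Let qaddN : left_inverse (qpi 0) qopp qadd.
Proof. by move=> x; elim/qind: x => x; rewrite !qE addNr. Qed.

HB.instance Definition _ :=
  GRing.isZmodule.Build qalg qaddA qaddC qadd0 qaddN.

Let qmulA : associative qmul.
Proof. by move=> x y z; elim/qind: x => x; elim/qind: y => y; elim/qind: z => z; rewrite !qE mulrA. Qed.
Let qmul1 : left_id (qpi 1) qmul.
Proof. by move=> x; elim/qind: x => x; rewrite !qE mul1r. Qed.
Let qmulr1 : right_id (qpi 1) qmul.
Proof. by move=> x; elim/qind: x => x; rewrite !qE mulr1. Qed.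
Let qmulDl : left_distributive qmul +%R.
Proof.
move=> x y z; elim/qind: x => x; elim/qind: y => y; elim/qind: z => z.
by rewrite /GRing.add /= !qE mulrDl.
Qed.
Let qmulDr : right_distributive qmul +%R.
Proof.
move=> x y z; elim/qind: x => x; elim/qind: y => y; elim/qind: z => z.
by rewrite /GRing.add /= !qE mulrDr.
Qed.

HB.instance Definition _ :=
  GRing.Zmodule_isPzRing.Build qalg qmulA qmul1 qmulr1 qmulDl qmulDr.

Let qscaleA a b v : qscale a (qscale b v) = qscale (a * b) v.
Proof. by elim/qind: v => v; rewrite !qE scalerA. Qed.
Let qscale1 : left_id 1 qscale.
Proof. by move=> x; elim/qind: x => x; rewrite !qE scale1r. Qed.
Let qscaleDr : right_distributive qscale +%R.
Proof.
by move=> a x y; elim/qind: x => x; elim/qind: y => y; rewrite /GRing.add /= !qE scalerDr.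
Qed.
Let qscaleDl v : {morph qscale^~ v : a b / a + b}.
Proof.
by elim/qind: v => v a b; rewrite [in RHS]/GRing.add /= !qE scalerDl.
Qed.

HB.instance Definition _ :=
  GRing.Zmodule_isLmodule.Build K qalg qscaleA qscale1 qscaleDr qscaleDl.

Lemma qalg_scalerAl (a : K) (x y : qalg) : a *: (x * y) = (a *: x) * y.
Proof.
elim/qind: x => x; elim/qind: y => y.
by rewrite /GRing.scale /GRing.mul /= !qE scalerAl.
Qed.

Lemma qalg_scalerAr (a : K) (x y : qalg) : a *: (x * y) = x * (a *: y).
Proof.
elim/qind: x => x; elim/qind: y => y.
by rewrite /GRing.scale /GRing.mul /= !qE scalerAr.
Qed.

Definition qalg_proj : A -> qalg := \pi_qalg.

Lemma qalg_proj_is_nmod_morphism : nmod_morphism qalg_proj.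
Proof. by split=> [//|x y]; rewrite [RHS]qaddE. Qed.
Lemma qalg_proj_is_monoid_morphism : monoid_morphism qalg_proj.
Proof. by split=> [//|x y]; rewrite [RHS]qmulE. Qed.
Lemma qalg_proj_is_scalable : scalable qalg_proj.
Proof. by move=> a x; rewrite [RHS]qscaleE. Qed.

HB.instance Definition _ :=
  GRing.isNmodMorphism.Build A qalg qalg_proj qalg_proj_is_nmod_morphism.
HB.instance Definition _ :=
  GRing.isMonoidMorphism.Build A qalg qalg_proj qalg_proj_is_monoid_morphism.
HB.instance Definition _ :=
  GRing.isScalable.Build K A qalg *:%R qalg_proj qalg_proj_is_scalable.

Section Lift.
Variables (B : pzRingType) (f : {rmorphism A -> B}).

Lemma ideal_gen_eq0 (fS : forall s, S s -> f s = 0) x : ideal_gen x -> f x = 0.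
Proof.
elim=> [s /fS //||y z _ fy _ fz|a y _ fy|y a _ fy]; first exact: rmorph0.
- by rewrite rmorphD fy fz addr0.
- by rewrite rmorphM fy mulr0.
- by rewrite rmorphM fy mul0r.
Qed.

Definition qalg_lift of (forall s, S s -> f s = 0) :=
  fun x : qalg => f (repr x) : B.

Variable fS : forall s, S s -> f s = 0.

Lemma qalg_liftE x : qalg_lift fS (qalg_proj x) = f x.
Proof.
by apply/eqP; rewrite -subr_eq0 -rmorphB ideal_gen_eq0 //; apply: reprI.
Qed.

Lemma qalg_lift_is_nmod_morphism : nmod_morphism (qalg_lift fS).
Proof.
split=> [|x y]; first by rewrite -(rmorph0 qalg_proj) qalg_liftE rmorph0.
elim/qind: x => x; elim/qind: y => y.
by rewrite -[qpi x + qpi y](rmorphD qalg_proj) !qalg_liftE rmorphD.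
Qed.

Lemma qalg_lift_is_monoid_morphism : monoid_morphism (qalg_lift fS).
Proof.
split=> [|x y]; first by rewrite -(rmorph1 qalg_proj) qalg_liftE rmorph1.
elim/qind: x => x; elim/qind: y => y.
by rewrite -[qpi x * qpi y](rmorphM qalg_proj) !qalg_liftE rmorphM.
Qed.

HB.instance Definition _ := GRing.isNmodMorphism.Build qalg B (qalg_lift fS)
  qalg_lift_is_nmod_morphism.
HB.instance Definition _ := GRing.isMonoidMorphism.Build qalg B (qalg_lift fS)
  qalg_lift_is_monoid_morphism.

Lemma qalg_neq0 : (1 : B) != 0 -> (1 : qalg) != 0.
Proof.
apply: contraNneq => /(congr1 (qalg_lift fS)).
by rewrite rmorph1 rmorph0 => ->.
Qed.

End Lift.
End QuotientAlgebra.
Arguments qalg_proj {K A S} x.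

Lemma malg_scalerAr (K : comNzRingType) (M : monomType) (a : K)
  (x y : {malg K[M]}) : a *: (x * y) = x * (a *: y).
Proof.
apply/malgP => k; rewrite mcoeffZ (mcoeffMl x y) mulr_sumr.
rewrite (mcoeffMlw k (fsubset_refl (msupp x)) (msuppZ_le a y)).
apply: eq_bigr => i _; rewrite mulr_sumr; apply: eq_bigr => j _.
by rewrite mcoeffZ mulrnAr mulrCA.
Qed.

Definition free_alg (K : fieldType) (I : choiceType) : Type :=
  {malg K[{fmonom I}]}.

Section FreeAlgebra.
Variables (K : fieldType) (I : choiceType).

HB.instance Definition _ := GRing.Lalgebra.on (free_alg K I).

Lemma free_alg_scalerAr (a : K) (x y : free_alg K I) :
  a *: (x * y) = x * (a *: y).
Proof. exact: malg_scalerAr. Qed.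

HB.instance Definition _ :=
  GRing.Lalgebra_isAlgebra.Build K (free_alg K I) free_alg_scalerAr.

End FreeAlgebra.

HB.lock Definition free_gen (K : fieldType) (I : choiceType) (i : I) :
  free_alg K I := << fmu i >>.
Arguments free_gen {K I} i.

Section FreeCharacter.
Variables (K : fieldType) (I : choiceType).

Definition const_mmorph (c : K) (m : {fmonom I}) : K := c ^+ fdeg m.

Lemma const_mmorph_mmorphism c : mmorphism (const_mmorph c).
Proof.
split=> [m1 m2|]; last by rewrite /const_mmorph /fdeg fm1.
by rewrite /const_mmorph fdegM exprD.
Qed.

HB.instance Definition _ c :=
  monalg.isMultiplicative.Build {fmonom I} K (const_mmorph c)
    (const_mmorph_mmorphism c).

(* The augmentation sending every generator to c. *)
Definition free_const (c : K) : {rmorphism free_alg K I -> K} :=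
  mmap (@idfun K) (const_mmorph c).

Lemma free_const_gen c i : free_const c (free_gen i) = c.
Proof.
by rewrite free_gen.unlock /= mmapU mul1r /const_mmorph /fdeg fmuE expr1.
Qed.

Lemma free_constZ c a x : free_const c (a *: x) = a * free_const c x.
Proof. exact: mmapZ. Qed.

End FreeCharacter.
Arguments free_const {K} I c.


Lemma rmorph_braid_eq0 (A B : pzRingType) (f : {rmorphism A -> B}) x y :
  f x = f y -> f (x * y * x - y * x * y) = 0.
Proof. by move=> fxy; rewrite rmorphB !rmorphM fxy subrr. Qed.

Lemma rmorph_comm_eq0 (A B : pzRingType) (f : {rmorphism A -> B}) x y :
  f x = f y -> f (x * y - y * x) = 0.
Proof. by move=> fxy; rewrite rmorphB !rmorphM fxy subrr. Qed.

Lemma rmorph_tl_eq0 (K : pzRingType) (A : lalgType K) (B : pzRingType)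
  (f : {rmorphism A -> B}) (c : K) x y :
  f x = 0 -> f (x * y * x - c *: x) = 0.
Proof.
by move=> fx0; rewrite rmorphB -mulr_algl !rmorphM fx0 !mulr0 subrr.
Qed.

Section HeckeAlgebra.
Variables (K : fieldType) (n : nat) (q : K).
(* The generator written g_(i+1) on paper is g i with i : 'I_n.-1. *)
Local Notation g i := (free_gen i : free_alg K 'I_n.-1).

Inductive hecke_rel : set (free_alg K 'I_n.-1) :=
| HeckeQuadratic i : hecke_rel ((g i + 1) * (g i - q%:A))
| HeckeBraid (i j : 'I_n.-1) of j = i.+1 :> nat :
    hecke_rel (g i * g j * g i - g j * g i * g j)
| HeckeFar (i j : 'I_n.-1) of (i.+1 < j)%N :
    hecke_rel (g i * g j - g j * g i).

Definition hecke : Type := qalg hecke_rel.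
HB.instance Definition _ := GRing.PzRing.on hecke.
HB.instance Definition _ := GRing.Lmodule.on hecke.

(* The character g_i |-> q shows that hecke and tl are nonzero rings, as
   MathComp's lalgType requires. *)
Let hecke_char_free : {rmorphism free_alg K 'I_n.-1 -> K} :=
  free_const 'I_n.-1 q.

Let hecke_char_rel s : hecke_rel s -> hecke_char_free s = 0.
Proof.
have fg i : hecke_char_free (g i) = q by apply: free_const_gen.
have fq : hecke_char_free q%:A = q.
  by rewrite [LHS]free_constZ rmorph1 mulr1.
case=> [i|i j _|i j _].
- by rewrite rmorphM rmorphB fq fg subrr mulr0.
- by apply: rmorph_braid_eq0; rewrite !fg.
- by apply: rmorph_comm_eq0; rewrite !fg.
Qed.

Lemma hecke_oner_neq0 : (1 : hecke) != 0.
Proof. exact: (qalg_neq0 hecke_char_rel (oner_neq0 K)). Qed.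

HB.instance Definition _ :=
  GRing.PzSemiRing_isNonZero.Build hecke hecke_oner_neq0.
HB.instance Definition _ :=
  GRing.LSemiModule_isLSemiAlgebra.Build K hecke
    (@qalg_scalerAl K _ hecke_rel).
HB.instance Definition _ :=
  GRing.LSemiAlgebra_isSemiAlgebra.Build K hecke
    (@qalg_scalerAr K _ hecke_rel).

Definition hecke_gen (i : 'I_n.-1) : hecke := qalg_proj (g i).

Definition hecke_e (i : 'I_n.-1) : hecke :=
  (q + 1)^-1 *: (q%:A - hecke_gen i).

Inductive tl_rel : set hecke :=
| TLRel (i j : 'I_n.-1) of j = i.+1 :> nat \/ i = j.+1 :> nat :
    tl_rel (hecke_e i * hecke_e j * hecke_e i
            - (q / (1 + q) ^+ 2) *: hecke_e i).

Definition tl : Type := qalg tl_rel.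
HB.instance Definition _ := GRing.PzRing.on tl.
HB.instance Definition _ := GRing.Lmodule.on tl.

Let hecke_char : {rmorphism hecke -> K} := qalg_lift hecke_char_rel.

Let hecke_charZ a x : hecke_char (a *: x) = a * hecke_char x.
Proof.
have projE y : hecke_char (qalg_proj y) = hecke_char_free y.
  exact: qalg_liftE.
rewrite -[x]reprK -[\pi_(_) _]/(qalg_proj (repr x)) -linearZ.
by rewrite projE projE; apply: free_constZ.
Qed.

Let hecke_char_tl s : tl_rel s -> hecke_char s = 0.
Proof.
have ce i : hecke_char (hecke_e i) = 0.
  rewrite hecke_charZ rmorphB hecke_charZ rmorph1 mulr1.
  have -> : hecke_char (hecke_gen i) = q.
    exact: etrans (qalg_liftE hecke_char_rel (g i)) (free_const_gen q i).
  by rewrite subrr mulr0.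
by case=> i j _; apply: rmorph_tl_eq0; apply: ce.
Qed.

Lemma tl_oner_neq0 : (1 : tl) != 0.
Proof. exact: (qalg_neq0 hecke_char_tl (oner_neq0 K)). Qed.

HB.instance Definition _ :=
  GRing.PzSemiRing_isNonZero.Build tl tl_oner_neq0.
HB.instance Definition _ :=
  GRing.LSemiModule_isLSemiAlgebra.Build K tl (@qalg_scalerAl K _ tl_rel).
HB.instance Definition _ :=
  GRing.LSemiAlgebra_isSemiAlgebra.Build K tl (@qalg_scalerAr K _ tl_rel).

Definition tl_proj : hecke -> tl := qalg_proj.
HB.instance Definition _ := GRing.LRMorphism.on tl_proj.

Definition tl_gen (i : 'I_n.-1) : tl := tl_proj (hecke_gen i).

End HeckeAlgebra.
Arguments hecke {K} n q.
Arguments tl {K} n q.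
Arguments hecke_gen {K n q} i.
Arguments tl_gen {K n q} i.
Arguments tl_proj {K n q} x.

Section TensorSpace.
Variables (C : numClosedFieldType) (d : nat).
Implicit Types R : 'M[C]_(d * d).

Lemma local_copy_dim n (i : 'I_n.-1) :
  (d ^ i * (d * d) * d ^ (n - i.+2) = d ^ n)%N.
Proof.
have le_in : (i.+2 <= n)%N by case: n i => [|n] [].
by rewrite -[(d * d)%N]/(d ^ 2)%N -!expnD addn2 subnKC.
Qed.

(* With i : 'I_n.-1 counted from 0, the factors V number i and i+1. *)
Definition local_copy n R (i : 'I_n.-1) : 'M[C]_(d ^ n) :=
  castmx (local_copy_dim i, local_copy_dim i)
    ((1%:M : 'M[C]_(d ^ i)) *t R *t (1%:M : 'M[C]_(d ^ (n - i.+2)))).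

Definition yang_baxter R : Prop :=
  let R12 := local_copy (n := 3) R ord0 in
  let R23 := local_copy (n := 3) R ord_max in
  R12 *m R23 *m R12 = R23 *m R12 *m R23.

Definition unitary_yang_baxter R : Prop := R \is unitarymx /\ yang_baxter R.

Definition two_eigenvalues R : Prop :=
  exists a b : C, a != b /\
    forall c, eigenvalue R c = (c == a) || (c == b).

Definition hecke_type (q : C) R : Prop :=
  [/\ unitary_yang_baxter R, two_eigenvalues R,
      (R + 1%:M) *m (R - q%:M) = 0 & q != -1].

Definition spectral_proj (q : C) R : 'M[C]_(d * d) :=
  (q + 1)^-1 *: (q%:M - R).

(* Meaningful when hecke_type q R holds; the size of R is d ^ 2. *)
Definition spectral_density (q : C) R : rat :=
  (\rank (spectral_proj q R))%:R / (d ^ 2)%:R.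

(* R localizes the tower of braid group representations into the algebras
   A n in which the i-th braid generator goes to g n i. *)
Definition localizes R (A : nat -> algType C)
    (g : forall n, 'I_n.-1 -> A n) : Prop :=
  unitary_yang_baxter R /\
  forall n, (2 <= n)%N ->
    exists tau : {lrmorphism A n -> 'M[C]_(d ^ n)},
      forall i, tau (g n i) = local_copy R i.

End TensorSpace.
Arguments localizes {C d} R A g.

Section Qutrit.
Variable R : realType.
Local Notation C := R[i].

Definition expi (t : R) : C := (cos t +i* sin t)%C.

Definition omega : C := expi (2 * pi / 3).
Definition h_TL : C := expi (- (pi / 3)).

(* X e_j = e_(j+1), with j + 1 computed in 'I_3 = Z/3, and Z e_j = omega^j e_j. *)
Definition pauliX : 'M[C]_3 := \matrix_(i, j) (i == j + 1)%:R.
Definition pauliZ : 'M[C]_3 := diag_mx (\row_j omega ^+ j).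

Definition U : 'M[C]_(3 * 3) := pauliZ *t pauliX.
Definition ZZ : 'M[C]_(3 * 3) := pauliZ *t pauliZ.

Definition R1 : 'M[C]_(3 * 3) :=
  ZZ *m ((Num.sqrt 3 : R)^-1%:C%C *: (1%:M + omega ^+ 2 *: (U + U ^+ 2))) *m invmx ZZ.

Definition R1t : 'M[C]_(3 * 3) := (- 'i%C) *: R1.

End Qutrit.

(* Main.v *)
From HB Require Import structures.
Require Import Defs.
From mathcomp Require Import all_boot all_order all_algebra.
From mathcomp Require Import boolp classical_sets reals trigo.
From mathcomp Require Import finmap zify ring.
From mathcomp.real_closed Require Import complex mxtens.
From mathcomp.multinomials Require Import monalg.
Import Order.TTheory GRing.Theory Num.Theory.
Local Open Scope ring_scope.

(* Conjugating U by Z (x) Z gives W = omega Z (x) X, which is unitary with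
   W^3 = 1. Since h_TL = - omega and i sqrt 3 = omega - omega^2, one finds
   R1t = h - (h + 1) p, where p = (1 + W + W^2) / 3 is the orthogonal projection
   on the fixed space of W; it has rank tr p = 3 because W and W^2 are traceless.
   Adjacent local copies satisfy W_(i+1) W_i = omega W_i W_(i+1), so W_(i+1) and
   its square are killed when sandwiched between two copies of p_i, whence
   p_i p_(i+1) p_i = p_i / 3 and h / (1 + h)^2 = 1 / 3. This Temperley-Lieb
   relation in turn implies the braid relation, hence the Yang-Baxter
   equation. *)

Set Implicit Arguments.
Unset Strict Implicit.
Unset Printing Implicit Defensive.

(** * Kronecker products of square matrices of varying size *)

Section TaggedTensor.
Variable C : comNzRingType.

(* Bundling a matrix with its size makes *t associative and unital for Leibniz
   equality, which absorbs the casts in local_copy. *)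
Definition tagged_mx n (A : 'M[C]_n) : {n : nat & 'M[C]_n} :=
  existT (fun n => 'M[C]_n) n A.

Lemma tagged_mx_inj n : injective (@tagged_mx n).
Proof. by move=> A B; rewrite /tagged_mx => /eqP; rewrite eq_Tagged => /eqP. Qed.

Lemma tagged_mx_cast m n (e : m = n) (A : 'M[C]_m) :
  tagged_mx (castmx (e, e) A) = tagged_mx A.
Proof. by case: n / e; rewrite castmx_id. Qed.

Lemma tagged_mx_dim m n (A : 'M[C]_m) (B : 'M[C]_n) :
  tagged_mx A = tagged_mx B -> m = n.
Proof. exact: (congr1 (@projT1 _ _)). Qed.

Definition tagged_tens (x y : {n : nat & 'M[C]_n}) : {n : nat & 'M[C]_n} :=
  tagged_mx (projT2 x *t projT2 y).

Lemma tagged_mx_tens m n (A : 'M[C]_m) (B : 'M[C]_n) :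
  tagged_mx (A *t B) = tagged_tens (tagged_mx A) (tagged_mx B).
Proof. by []. Qed.

(** Both bracketings read the same three mixed-radix digits off an index below m * n * p, so after
    one cast only arithmetic of quotients and remainders remains. *)
Lemma tagged_tensA : associative tagged_tens.
Proof.
case=> m A [n B] [p D]; rewrite /tagged_tens /=.
rewrite -(tagged_mx_cast (mulnA m n p)); congr tagged_mx.
apply/matrixP=> i j; rewrite castmxE !mxE mulrA /=.
congr (A _ _ * B _ _ * D _ _); apply: val_inj => /=.
- by rewrite (mulnC n p) divnMA.
- by rewrite (mulnC n p) divnMA.
- by rewrite modn_divl.
- by rewrite modn_divl.
- by rewrite modn_dvdm // dvdn_mull.
- by rewrite modn_dvdm // dvdn_mull.
Qed.

Lemma tensmxZl m n p q c (A : 'M[C]_(m, n)) (B : 'M[C]_(p, q)) :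
  (c *: A) *t B = c *: (A *t B).
Proof. by apply/matrixP=> i j; rewrite !mxE mulrA. Qed.

Lemma tensmxZr m n p q c (A : 'M[C]_(m, n)) (B : 'M[C]_(p, q)) :
  A *t (c *: B) = c *: (A *t B).
Proof. by apply/matrixP=> i j; rewrite !mxE mulrCA. Qed.

Lemma tensmx1 m n : (1%:M : 'M[C]_m) *t (1%:M : 'M[C]_n) = 1%:M.
Proof.
apply/matrixP=> i j; case: (mxtens_indexP i) => i1 i2.
case: (mxtens_indexP j) => j1 j2; rewrite tensmxE !mxE.
by rewrite -natrM mulnb (can_eq (@mxtens_indexK m n)) xpair_eqE.
Qed.

(** The operators act on complementary tensor legs. The size D stays free: the tagged equation for X
    forces D = m * n, so no cast has to be written. *)
Lemma tagged_tens_comm D m n (X Y : 'M[C]_D) (P : 'M[C]_m) (Q : 'M[C]_n) :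
  tagged_mx X = tagged_mx (P *t (1%:M : 'M_n)) ->
  tagged_mx Y = tagged_mx ((1%:M : 'M_m) *t Q) ->
  X *m Y = Y *m X.
Proof.
move=> eX; have eD := tagged_mx_dim eX; subst D.
move=> /tagged_mx_inj->; move/tagged_mx_inj: eX => ->.
by rewrite !tensmx_mul !mulmx1 !mul1mx.
Qed.

Lemma tagged_tens_qcomm D l m r (X Y : 'M[C]_D) (P Q : 'M[C]_m) (c : C) :
  tagged_mx X = tagged_mx ((1%:M : 'M_l) *t P *t (1%:M : 'M_r)) ->
  tagged_mx Y = tagged_mx ((1%:M : 'M_l) *t Q *t (1%:M : 'M_r)) ->
  Q *m P = c *: (P *m Q) -> Y *m X = c *: (X *m Y).
Proof.
move=> eX; have eD := tagged_mx_dim eX; subst D.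
move=> /tagged_mx_inj->; move/tagged_mx_inj: eX => -> QP.
rewrite !tensmx_mul !mulmx1 QP.
by rewrite tensmxZr tensmxZl.
Qed.

End TaggedTensor.

(** * Compatibility of local copies with the algebra structure *)

Section LocalCopies.
Variables (C : numClosedFieldType) (d n : nat) (i : 'I_n.-1).
Implicit Types A B : 'M[C]_(d * d).

Lemma tagged_local_copy A : tagged_mx (local_copy A i) =
  tagged_mx ((1%:M : 'M_(d ^ i)) *t A *t (1%:M : 'M_(d ^ (n - i.+2)))).
Proof. exact: tagged_mx_cast. Qed.

Lemma local_copyD A B : local_copy (A + B) i = local_copy A i + local_copy B i.
Proof.
by apply/matrixP=> x y; rewrite !(castmxE, mxE) mulrDr mulrDl.
Qed.

Lemma local_copyZ c A : local_copy (c *: A) i = c *: local_copy A i.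
Proof.
rewrite /local_copy tensmxZr tensmxZl.
by apply/matrixP=> x y; rewrite !(castmxE, mxE).
Qed.

Lemma local_copyN A : local_copy (- A) i = - local_copy A i.
Proof. by rewrite -scaleN1r local_copyZ scaleN1r. Qed.

Lemma local_copyM A B : local_copy (A *m B) i = local_copy A i *m local_copy B i.
Proof.
rewrite /local_copy -[X in _ *t X]mulmx1 -[X in X *t _ *t _]mulmx1.
(* Destructing the generalised dimension equation turns the casts into identities. *)
rewrite -!tensmx_mul; move: (local_copy_dim d i); case: _ /.
by rewrite !castmx_id.
Qed.

Lemma local_copy1 : local_copy (1%:M : 'M[C]_(d * d)) i = 1%:M.
Proof.
by apply: tagged_mx_inj; rewrite tagged_local_copy !tensmx1 local_copy_dim.
Qed.

End LocalCopies.

(** * Local copies at disjoint and at overlapping sites *)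

Section LocalCopyCommutation.
Variables (C : numClosedFieldType) (d n : nat).

Lemma local_copy_far (i j : 'I_n.-1) (A B : 'M[C]_(d * d)) :
  (i.+1 < j)%N ->
  local_copy A i *m local_copy B j = local_copy B j *m local_copy A i.
Proof.
move=> ij; have jn : (j.+2 <= n)%N by case: n j {ij} => [|k] [].
have em : (d ^ (n - i.+2) = d ^ (j - i.+2) * (d * d) * d ^ (n - j.+2))%N.
  by rewrite -(expnD d 1 1) -!expnD; congr expn; lia.
have ej : (d ^ j = d ^ i * (d * d) * d ^ (j - i.+2))%N.
  by rewrite -(expnD d 1 1) -!expnD; congr expn; lia.
(* The tensor power is cut just after the two sites of A; B lies entirely to the right of the cut,
   after j - i - 2 idle sites. *)
apply: (tagged_tens_comm (P := (1%:M : 'M_(d ^ i)) *t A)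
  (Q := (1%:M : 'M_(d ^ (j - i.+2))) *t B *t (1%:M : 'M_(d ^ (n - j.+2)))));
  rewrite tagged_local_copy ?em //.
by rewrite ej -(tensmx1 C (d ^ i * (d * d))) !tagged_mx_tens -!tagged_tensA.
Qed.

(** On simple tensors the two copies meet only at the middle one of three sites, where B1 has to
    pass A2; the factor c arises there. *)
Lemma local_copy_adjacent (i j : 'I_n.-1) (A1 A2 B1 B2 : 'M[C]_d) c :
  j = i.+1 :> nat -> B1 *m A2 = c *: (A2 *m B1) ->
  local_copy (B1 *t B2) j *m local_copy (A1 *t A2) i =
    c *: (local_copy (A1 *t A2) i *m local_copy (B1 *t B2) j).
Proof.
move=> ij BA; have jn : (j.+2 <= n)%N by case: n j {ij} => [|k] [].
have em : (d ^ (n - i.+2) = d * d ^ (n - j.+2))%N.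
  by rewrite -expnS; congr expn; lia.
have ej : (d ^ j = d ^ i * d)%N by rewrite -expnSr; congr expn; lia.
apply: (tagged_tens_qcomm (l := d ^ i) (r := d ^ (n - j.+2))
  (P := A1 *t A2 *t (1%:M : 'M_d)) (Q := (1%:M : 'M_d) *t B1 *t B2)).
- by rewrite tagged_local_copy em -tensmx1 !tagged_mx_tens -!tagged_tensA.
- by rewrite tagged_local_copy ej -tensmx1 !tagged_mx_tens -!tagged_tensA.
rewrite !tensmx_mul !mulmx1 !mul1mx BA.
by rewrite tensmxZr tensmxZl.
Qed.

End LocalCopyCommutation.

(** * Universal properties of the free algebra and of quotient algebras *)

Section FreeEval.
Variables (K : fieldType) (I : choiceType) (B : algType K) (f : I -> B).

Definition fmonom_eval (m : {fmonom I}) : B := \prod_(i <- m) f i.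

Lemma fmonom_eval_mmorphism : mmorphism fmonom_eval.
Proof.
by split=> [m1 m2|]; rewrite /fmonom_eval ?fmM ?big_cat // fm1 big_nil.
Qed.

HB.instance Definition _ :=
  monalg.isMultiplicative.Build {fmonom I} B fmonom_eval fmonom_eval_mmorphism.

Definition free_eval : free_alg K I -> B := mmap (in_alg B) fmonom_eval.

Lemma free_eval_is_nmod_morphism : nmod_morphism free_eval.
Proof. by split; [apply: raddf0 | apply: raddfD]. Qed.

Lemma free_eval_is_monoid_morphism : monoid_morphism free_eval.
Proof.
have [fM f1] : multiplicative free_eval.
  (* The target may be noncommutative because coefficients become central scalars. *)
  apply: commr_mmap_is_multiplicative => g m m'.
  by rewrite /GRing.comm /= mulr_algl mulr_algr.
by split.
Qed.

Lemma free_eval_is_scalable : scalable free_eval.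
Proof. by move=> a x; rewrite /free_eval mmapZ /= mulr_algl. Qed.

HB.instance Definition _ := GRing.isNmodMorphism.Build (free_alg K I) B
  free_eval free_eval_is_nmod_morphism.
HB.instance Definition _ := GRing.isMonoidMorphism.Build (free_alg K I) B
  free_eval free_eval_is_monoid_morphism.
HB.instance Definition _ := GRing.isScalable.Build K (free_alg K I) B *:%R
  free_eval free_eval_is_scalable.

Lemma free_eval_gen i : free_eval (free_gen i) = f i.
Proof.
by rewrite free_gen.unlock /free_eval mmapU /= scale1r mul1r /fmonom_eval fmuE
  big_seq1.
Qed.

End FreeEval.

Section QuotientLift.
Local Open Scope quotient_scope.
Variables (K : fieldType) (A B : algType K) (S : set A).

(** Upgrades the ring morphism [qalg_lift] to an algebra morphism: each class is the projection of
    its representative, so scalars pass through f. *)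
Lemma qalg_lift_scalable (f : {lrmorphism A -> B})
    (fS : forall s, S s -> f s = 0) :
  scalable (qalg_lift (f := f) fS).
Proof.
move=> a x; rewrite -[x]reprK -[\pi_(_) _]/(qalg_proj (repr x)) -linearZ.
by rewrite !(qalg_liftE (f := f)); apply: linearZ.
Qed.

End QuotientLift.

(** * Representations of the Hecke and Temperley-Lieb algebras from their relations *)

Section RelationImages.
Variables (K : fieldType) (A B : algType K) (f : {lrmorphism A -> B}).
Implicit Types (x y : A) (c : K).

Lemma lrmorphZ c x : f (c *: x) = c *: f x.
Proof. exact: linearZ. Qed.

Lemma lrmorph_quadratic x c :
  f ((x + 1) * (x - c%:A)) = (f x + 1) * (f x - c%:A).
Proof. by rewrite rmorphM rmorphB rmorphD /= lrmorphZ !rmorph1. Qed.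

Lemma lrmorph_braid x y :
  f (x * y * x - y * x * y) = f x * f y * f x - f y * f x * f y.
Proof. by rewrite rmorphB !rmorphM. Qed.

Lemma lrmorph_comm x y : f (x * y - y * x) = f x * f y - f y * f x.
Proof. by rewrite rmorphB !rmorphM. Qed.

Lemma lrmorph_tl x y c a b : f x = a -> f y = b ->
  f (x * y * x - c *: x) = a * b * a - c *: a.
Proof. by move=> <- <-; rewrite rmorphB !rmorphM /= lrmorphZ. Qed.

Lemma lrmorph_scaled_diff x a c : f (a *: (c%:A - x)) = a *: (c%:A - f x).
Proof. by rewrite lrmorphZ rmorphB /= lrmorphZ rmorph1. Qed.

End RelationImages.

Section TLLift.
Variables (K : fieldType) (n : nat) (q : K) (B : algType K).
Variable g : 'I_n.-1 -> B.
Let e i := (q + 1)^-1 *: (q%:A - g i).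

Hypothesis g_quadratic : forall i, (g i + 1) * (g i - q%:A) = 0.
Hypothesis g_braid : forall i j : 'I_n.-1, j = i.+1 :> nat ->
  g i * g j * g i = g j * g i * g j.
Hypothesis g_far : forall i j : 'I_n.-1, (i.+1 < j)%N -> g i * g j = g j * g i.
Hypothesis e_tl : forall i j : 'I_n.-1, j = i.+1 :> nat \/ i = j.+1 :> nat ->
  e i * e j * e i = (q / (1 + q) ^+ 2) *: e i.

Lemma free_eval_hecke s : hecke_rel q s -> free_eval g s = 0.
Proof.
case=> [i|i j ij|i j ij].
- by rewrite lrmorph_quadratic /= free_eval_gen g_quadratic.
- by rewrite lrmorph_braid /= !free_eval_gen g_braid // subrr.
- by rewrite lrmorph_comm /= !free_eval_gen g_far // subrr.
Qed.

Definition hecke_lift : hecke n q -> B := qalg_lift free_eval_hecke.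

HB.instance Definition _ := GRing.RMorphism.on hecke_lift.
HB.instance Definition _ := GRing.isScalable.Build K (hecke n q) B *:%R
  hecke_lift (qalg_lift_scalable (f := free_eval g) free_eval_hecke).

Lemma hecke_lift_gen i : hecke_lift (hecke_gen i) = g i.
Proof.
by rewrite -(free_eval_gen g); apply: (qalg_liftE (f := free_eval g)).
Qed.

Lemma hecke_lift_tl s : tl_rel s -> hecke_lift s = 0.
Proof.
have he i : hecke_lift (hecke_e q i) = e i.
  by rewrite lrmorph_scaled_diff /= hecke_lift_gen.
case=> i j ij; apply: etrans (lrmorph_tl (f := hecke_lift) _ (he i) (he j)) _.
by rewrite e_tl ?subrr.
Qed.

Definition tl_lift : tl n q -> B := qalg_lift hecke_lift_tl.

HB.instance Definition _ := GRing.RMorphism.on tl_lift.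
HB.instance Definition _ := GRing.isScalable.Build K (tl n q) B *:%R
  tl_lift (qalg_lift_scalable (f := hecke_lift) hecke_lift_tl).

Lemma tl_lift_gen i : tl_lift (tl_gen i) = g i.
Proof.
by rewrite -hecke_lift_gen; apply: (qalg_liftE (f := hecke_lift)).
Qed.

Lemma tl_liftP : exists rho : {lrmorphism tl n q -> B},
  forall i, rho (tl_gen i) = g i.
Proof. by exists tl_lift; apply: tl_lift_gen. Qed.

End TLLift.

Lemma tl_lift_mx (K : fieldType) n (q : K) N (g : 'I_n.-1 -> 'M[K]_N) :
  let e i := (q + 1)^-1 *: (q%:M - g i) in
  (0 < N)%N ->
  (forall i, (g i + 1%:M) *m (g i - q%:M) = 0) ->
  (forall i j : 'I_n.-1, j = i.+1 :> nat ->
     g i *m g j *m g i = g j *m g i *m g j) ->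
  (forall i j : 'I_n.-1, (i.+1 < j)%N -> g i *m g j = g j *m g i) ->
  (forall i j : 'I_n.-1, j = i.+1 :> nat \/ i = j.+1 :> nat ->
     e i *m e j *m e i = (q / (1 + q) ^+ 2) *: e i) ->
  exists rho : {lrmorphism tl n q -> 'M[K]_N},
    forall i, rho (tl_gen i) = g i.
Proof.
(* A matrix ring is nonzero, as an [algType] must be, only in positive size. *)
case: N g => // N g e _ gq gb gf ge.
have qA : q%:A = q%:M :> 'M[K]_N.+1 by exact: scalemx1.
by apply: tl_liftP => // [i|i j ij]; rewrite qA; [apply: gq | apply: ge].
Qed.

(** Serves to kill sandwiches and traces that q-commutation shows to be nontrivial multiples of
    themselves. *)
Lemma scale_fixed_eq0 (K : fieldType) (V : lmodType K) (c : K) (v : V) :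
  c != 1 -> v = c *: v -> v = 0.
Proof.
move=> c1 /eqP; rewrite -subr_eq0 -{1}[v]scale1r -scalerBl scaler_eq0.
by rewrite subr_eq0 eq_sym (negPf c1) => /eqP.
Qed.

(** * Hecke generators built from idempotents *)

Section QuadraticRelation.
Variables (K : fieldType) (N : nat) (q : K).
Implicit Types e f : 'M[K]_N.

(** Solves e = (q - g) / (q + 1) for g; for idempotent e it acts as -1 on the image of e and as q on
    the kernel. *)
Definition idem_gen e := q%:M - (q + 1) *: e.

Lemma idem_gen_quadratic e :
  e *m e = e -> (idem_gen e + 1%:M) *m (idem_gen e - q%:M) = 0.
Proof.
move=> ee; have -> : idem_gen e - q%:M = - ((q + 1) *: e).
  by rewrite /idem_gen addrAC subrr add0r.
rewrite mulmxN -scalemxAr mulmxDl mulmxBl -scalemxAl ee mul1mx mul_scalar_mx.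
by apply/matrixP => i j; rewrite !mxE; ring.
Qed.

(** With E = (q + 1) e and F = (q + 1) f one has E^2 = (q + 1) E and E F E = q E, so (q - E)(q -
    F)(q - E) expands to q^3 - q^2 (E + F) + q (E F + F E), which is symmetric in E and F. *)
Lemma idem_gen_braid e f :
    q + 1 != 0 -> e *m e = e -> f *m f = f ->
    e *m f *m e = (q / (1 + q) ^+ 2) *: e ->
    f *m e *m f = (q / (1 + q) ^+ 2) *: f ->
  idem_gen e *m idem_gen f *m idem_gen e =
    idem_gen f *m idem_gen e *m idem_gen f.
Proof.
move=> q1 ee ff efe fef; rewrite /idem_gen.
have scale3 (x y : 'M[K]_N) : x *m y *m x = (q / (1 + q) ^+ 2) *: x ->
    ((q + 1) *: x) *m ((q + 1) *: y) *m ((q + 1) *: x) = q *: ((q + 1) *: x).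
  move=> xyx; rewrite -!scalemxAl -!scalemxAr -scalemxAl xyx !scalerA.
  by congr (_ *: _); field; rewrite addrC.
have scale2 (x : 'M[K]_N) : x *m x = x ->
    ((q + 1) *: x) *m ((q + 1) *: x) = (q + 1) *: ((q + 1) *: x).
  by move=> xx; rewrite -scalemxAl -scalemxAr xx.
move: (scale2 _ ee) (scale2 _ ff) (scale3 _ _ efe) (scale3 _ _ fef).
move: (_ *: e) (_ *: f) => E F EE FF EFE FEF.
rewrite !(mulmxBl, mulmxBr, mul_scalar_mx, mul_mx_scalar).
rewrite -?(scalemxAl, scalemxAr) !mul_scalar_mx EE FF EFE FEF.
by apply/matrixP => i j; rewrite !mxE; ring.
Qed.

Lemma idem_genK e : q + 1 != 0 -> (q + 1)^-1 *: (q%:M - idem_gen e) = e.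
Proof. by move=> q1; rewrite subKr scalerK. Qed.

(** The quadratic relation leaves only -1 and q. Both occur, since eigenvectors are row vectors here
    and any nonzero row of e, respectively of 1 - e, is one. *)
Lemma eigenvalue_idem_gen e c : e *m e = e -> e != 0 -> e != 1%:M ->
  eigenvalue (idem_gen e) c = (c == -1) || (c == q).
Proof.
move=> ee e0 e1; apply/eigenvalueP/orP=> [[v vc v0]|].
  have /eqP : (c + 1) * (c - q) *: v = 0.
    rewrite -(mulmx0 _ v) -(idem_gen_quadratic ee) mulmxA (mulmxDr v) vc mulmx1.
    rewrite mulmxBr mulmxDl mul_mx_scalar -scalemxAl vc scalerA.
    by apply/matrixP => i j; rewrite !mxE; ring.
  rewrite scaler_eq0 (negPf v0) orbF mulf_eq0 addr_eq0 subr_eq0.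
  by move/orP.
have row_ev (f : 'M[K]_N) d : f != 0 -> f *m idem_gen e = d *: f ->
    exists2 v : 'rV_N, v *m idem_gen e = d *: v & v != 0.
  move=> f0 fd; have [i fi] : exists i, row i f != 0.
    apply/existsP; apply: contraNT f0; rewrite negb_exists => /forallP f0.
    apply/eqP/row_matrixP => i; rewrite row0; apply/eqP.
    by rewrite -[_ == _]negbK f0.
  by exists (row i f) => //; rewrite -row_mul fd linearZ.
have eR : e *m idem_gen e = - e.
  rewrite mulmxBr -scalemxAr ee mul_mx_scalar.
  by apply/matrixP => i j; rewrite !mxE; ring.
case=> /eqP->; first by apply: (row_ev e) => //; rewrite scaleN1r.
apply: (row_ev (1%:M - e)); first by rewrite subr_eq0 eq_sym.
by rewrite mulmxBl mul1mx eR /idem_gen; apply/matrixP => i j; rewrite !mxE; ring.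
Qed.

End QuadraticRelation.

(** * Averages over the powers of a matrix with cube one *)

Section CubicAverage.
Variables (K : fieldType) (N : nat).
Implicit Types W V A Q : 'M[K]_N.

Definition cubic_avg W : 'M[K]_N := 3^-1 *: (1%:M + W + W *m W).

Lemma cubic_avg_absl W :
  W *m W *m W = 1%:M -> W *m cubic_avg W = cubic_avg W.
Proof.
move=> W3; rewrite -scalemxAr !mulmxDr mulmx1 mulmxA W3.
by rewrite /cubic_avg addrC addrA.
Qed.

Lemma cubic_avg_absr W :
  W *m W *m W = 1%:M -> cubic_avg W *m W = cubic_avg W.
Proof.
move=> W3; rewrite -scalemxAl !mulmxDl mul1mx W3.
by rewrite /cubic_avg addrC addrA.
Qed.

Lemma cubic_avg_idem W : 3 != 0 :> K ->
  W *m W *m W = 1%:M -> cubic_avg W *m cubic_avg W = cubic_avg W.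
Proof.
move=> K3 W3; rewrite {2}/cubic_avg -scalemxAr !mulmxDr mulmx1 mulmxA.
rewrite !cubic_avg_absr //; apply/matrixP => i j; rewrite !mxE; field.
exact: K3.
Qed.

(** Writing p for the average, p A p = p A W p = c p W A p = c p A p. *)
Lemma cubic_avg_sandwich0 W A c : W *m W *m W = 1%:M -> c != 1 ->
  A *m W = c *: (W *m A) -> cubic_avg W *m A *m cubic_avg W = 0.
Proof.
move=> W3 c1 AW; apply: (scale_fixed_eq0 c1).
have := cubic_avg_absr W3; have := cubic_avg_absl W3.
move: (cubic_avg W) => p Wp pW; rewrite -{2}Wp mulmxA -[_ *m A *m W]mulmxA AW.
by rewrite -scalemxAr -scalemxAl mulmxA pW.
Qed.

(** Expand the middle average: the identity contributes p p = p, while V and V^2 pass W with factors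
    c and c^2 and so vanish between two copies of p. *)
Lemma cubic_avg_sandwich W V c : 3 != 0 :> K ->
    W *m W *m W = 1%:M -> c != 1 -> c * c != 1 -> V *m W = c *: (W *m V) ->
  cubic_avg W *m cubic_avg V *m cubic_avg W = 3^-1 *: cubic_avg W.
Proof.
move=> K3 W3 c1 cc1 VW; have p1 := cubic_avg_idem K3 W3.
have p2 := cubic_avg_sandwich0 W3 c1 VW.
have p3 : cubic_avg W *m (V *m V) *m cubic_avg W = 0.
  apply: (cubic_avg_sandwich0 W3 cc1).
  rewrite -mulmxA VW -scalemxAr (mulmxA V W V) VW -scalemxAl scalerA.
  by rewrite -mulmxA.
move: (cubic_avg W) p1 p2 p3 => p p1 p2 p3.
rewrite -scalemxAr -scalemxAl !mulmxDr !mulmxDl mulmx1.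
by rewrite p1 p2 p3 !addr0.
Qed.

(** A equals c times a conjugate of itself, and the trace is invariant under conjugation. *)
Lemma mxtrace_qcomm_eq0 Q A c : Q \in unitmx -> c != 1 ->
  Q *m A = c *: (A *m Q) -> \tr A = 0.
Proof.
move=> uQ c1 QA; apply: (scale_fixed_eq0 (V := K^o) c1).
rewrite -{1}(mulKmx uQ A) QA -scalemxAr mxtraceZ mxtrace_mulC.
by rewrite mulmxK.
Qed.

Lemma mxtrace_cubic_avg Q W c : Q \in unitmx -> c != 1 -> c * c != 1 ->
  Q *m W = c *: (W *m Q) -> \tr (cubic_avg W) = N%:R / 3.
Proof.
move=> uQ c1 cc1 QW; rewrite mxtraceZ !mxtraceD mxtrace1.
rewrite (mxtrace_qcomm_eq0 uQ c1 QW) (mxtrace_qcomm_eq0 uQ cc1).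
  by rewrite !addr0 mulrC.
by rewrite mulmxA QW -scalemxAl -mulmxA QW -scalemxAr scalerA mulmxA.
Qed.

End CubicAverage.

(** In a full rank factorization e = C D, cancelling the outer factors in C D C D = C D gives D C =
    1, of size the rank; and tr (C D) = tr (D C). *)
Lemma mxrank_idem_trace (K : fieldType) N (e : 'M[K]_N) :
  e *m e = e -> (\rank e)%:R = \tr e.
Proof.
move=> ee; have CD := mulmx_base e.
have /row_freeP[D' DD'] := row_base_free e.
have /row_fullP[C' CC'] := col_base_full e.
move: (col_base e) (row_base e) CD DD' CC' => C D CD DD' CC'.
suff DC : D *m C = 1%:M by rewrite -[in RHS]CD mxtrace_mulC DC mxtrace1.
have : C *m D *m (C *m D) = C *m D by rewrite CD.
move/(congr1 (fun X => C' *m X *m D')).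
by rewrite !mulmxA CC' !mul1mx -!mulmxA DD' !mulmx1.
Qed.

(** * The primitive cube root of unity and the square root of 3 *)

Section RootsOfUnity.
Variable R : realType.
Local Notation C := R[i].
Local Notation w := (omega R).

Lemma expiD (a b : R) : expi (a + b) = expi a * expi b.
Proof.
rewrite /expi cosD sinD; apply/eqP; rewrite eq_complex /= eqxx.
by rewrite addrC eqxx.
Qed.

Lemma expi0 : expi 0 = 1 :> C.
Proof. by rewrite /expi cos0 sin0. Qed.

Lemma expiNpi : expi (- pi) = -1 :> C.
Proof.
rewrite /expi cosN sinN cospi sinpi; apply/eqP.
by rewrite eq_complex /= !oppr0 !eqxx.
Qed.

Lemma expi_mul_conj (t : R) : expi t * (expi t)^* = 1.
Proof. by rewrite -normCK normc_def /= cos2Dsin2 sqrtr1 expr1n. Qed.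

Lemma expi_neq0 (t : R) : expi t != 0.
Proof.
have := oner_neq0 C; apply: contra_neq => e0.
by rewrite -(expi_mul_conj t) e0 mul0r.
Qed.

Lemma expi_conj (t : R) : (expi t)^* = expi (- t).
Proof.
by apply: (mulfI (expi_neq0 t)); rewrite expi_mul_conj -expiD subrr expi0.
Qed.

Lemma omega3 : w * w * w = 1.
Proof.
rewrite /omega -!expiD.
(* The angle 2 pi is put in the form that [expi_conj] and [expiNpi] can evaluate. *)
have -> : 2 * pi / 3 + 2 * pi / 3 + 2 * pi / 3 = - (- pi + - pi) :> R by field.
by rewrite -expi_conj expiD expiNpi mulrNN mulr1 conjC1.
Qed.

Lemma omega_conj : w^* = w * w.
Proof.
by apply: (mulfI (expi_neq0 (2 * pi / 3))); rewrite mulrA omega3 expi_mul_conj.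
Qed.

Lemma sin_omega_gt0 : 0 < sin (2 * pi / 3 : R).
Proof.
apply: sin_gt0_pi; have := pi_gt0 R => p0.
by rewrite divr_gt0 ?mulr_gt0 //= ltr_pdivrMr // mulrC ltr_pM2l // ltr_nat.
Qed.

Lemma omega_neq1 : w != 1.
Proof. by rewrite eq_complex negb_and /= orbC gt_eqF ?sin_omega_gt0. Qed.

Lemma omega_sum : 1 + w + w * w = 0.
Proof.
have /eqP : (1 - w) * (1 + w + w * w) = 0.
  have -> : (1 - w) * (1 + w + w * w) = 1 - w * w * w by ring.
  by rewrite omega3 subrr.
by rewrite mulf_eq0 subr_eq0 eq_sym (negPf omega_neq1) => /eqP.
Qed.

Lemma h_TLE : h_TL R = - w.
Proof.
by rewrite -[RHS]mulN1r -expiNpi -expiD; congr expi; field.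
Qed.

Lemma sqrt3_sin : Num.sqrt 3 = 2 * sin (2 * pi / 3 : R).
Proof.
have s0 := sin_omega_gt0.
(* This is the imaginary part of 1 + w + w^2 = 0; as the sine is positive, it yields cos = -1/2 and
   then sin^2 = 3/4. *)
have : sin (2 * pi / 3 : R) * (1 + 2 * cos (2 * pi / 3)) = 0.
  have /(congr1 (@complex.Im R)) := omega_sum.
  rewrite /omega /expi /= => <-; ring.
move/eqP; rewrite mulf_eq0 gt_eqF //= => /eqP c0.
have sc := cos2Dsin2 (2 * pi / 3 : R).
rewrite -(ger0_norm (ltW (mulr_gt0 (ltr0n R 2) s0))) -sqrtr_sqr; congr Num.sqrt.
move: c0 sc; move: (sin _) (cos _) => x y c0 sc.
have -> : (2 * x) ^+ 2 = 4 * (y ^+ 2 + x ^+ 2) - (1 + 2 * y - 1) ^+ 2 by ring.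
by rewrite sc c0; ring.
Qed.

Lemma sqrt3i : 'i%C * (Num.sqrt 3 : R)%:C%C = w - w * w.
Proof.
rewrite -omega_conj expi_conj; apply/eqP.
rewrite eq_complex /= sqrt3_sin cosN sinN.
by apply/andP; split; apply/eqP; ring.
Qed.

Lemma omega2_neq1 : w * w != 1.
Proof.
have := omega_neq1; apply: contra_neq => ww.
by rewrite -omega3 ww mul1r.
Qed.

End RootsOfUnity.

(** * Pauli matrices and the normal form of the Yang-Baxter operator *)

Section Pauli.
Variable R : realType.
Local Notation C := R[i].
Local Notation w := (omega R).
Local Notation Z := (pauliZ R).
Local Notation X := (pauliX R).

Lemma pauliZX : Z *m X = w *: (X *m Z).
Proof.
apply/matrixP => -[[|[|[|//]]] i] [[|[|[|//]]] j];
  rewrite !(mxE, big_ord_recl, big_ord0) /=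
    !(mulr1n, mulr0n, expr0, expr1, expr2).
(* [omega3] serves the last column, where the index wraps around modulo 3. *)
all: by rewrite !(mul0r, mulr0, mul1r, mulr1, add0r, addr0) ?mulrA ?omega3.
Qed.

Lemma pauliZ3 : Z *m Z *m Z = 1%:M.
Proof.
rewrite /pauliZ !mulmx_diag; apply/matrixP => i j; rewrite !mxE.
by rewrite -!exprMn omega3 expr1n.
Qed.

Lemma pauliX3 : X *m X *m X = 1%:M.
Proof.
by apply/matrixP => -[[|[|[|//]]] i] [[|[|[|//]]] j];
  rewrite !(mxE, big_ord_recl, big_ord0) /=
    !(mul0r, mulr0, mul1r, mulr1, add0r, addr0).
Qed.

(** The inverse is written as a square, so that unitarity and cube one combine without [invmx]. *)
Lemma pauliZ_adj : map_mx Num.conj Z^T = Z *m Z.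
Proof.
rewrite /pauliZ mulmx_diag tr_diag_mx map_diag_mx; congr diag_mx.
by apply/rowP => j; rewrite !mxE rmorphXn /= omega_conj exprMn.
Qed.

Lemma pauliX_adj : map_mx Num.conj X^T = X *m X.
Proof.
by apply/matrixP => -[[|[|[|//]]] i] [[|[|[|//]]] j];
  rewrite !(mxE, big_ord_recl, big_ord0) /=
    !(mul0r, mulr0, mul1r, mulr1, add0r, addr0) ?conjC0 ?conjC1.
Qed.

(* U conjugated by Z (x) Z: the second factor X becomes Z X Z^-1 = omega X. *)
Definition twistedU : 'M[C]_(3 * 3) := (w *: Z) *t X.
Local Notation W := twistedU.

Lemma twistedU3 : W *m W *m W = 1%:M.
Proof.
rewrite !tensmx_mul pauliX3 -!scalemxAl -!scalemxAr -!scalemxAl !scalerA.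
by rewrite ?mulrA pauliZ3 omega3 scale1r tensmx1.
Qed.

Lemma twistedU_adj : map_mx Num.conj W^T = W *m W.
Proof.
rewrite trmx_tens map_mxT pauliX_adj linearZ /= map_mxZ /= pauliZ_adj omega_conj.
by rewrite tensmx_mul -scalemxAl -scalemxAr scalerA.
Qed.

Lemma ZZ_U : ZZ R *m U R = W *m ZZ R.
Proof.
rewrite !tensmx_mul pauliZX -scalemxAl.
by rewrite tensmxZl tensmxZr.
Qed.

(** This q-commutation with an invertible matrix makes W and W^2 traceless. *)
Lemma ZZ_twistedU : ZZ R *m W = w *: (W *m ZZ R).
Proof.
by rewrite !tensmx_mul pauliZX -scalemxAl -scalemxAr tensmxZr.
Qed.

Lemma ZZ_unit : ZZ R \in unitmx.
Proof.
have : ZZ R *m ((Z *m Z) *t (Z *m Z)) = 1%:M.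
  by rewrite tensmx_mul !mulmxA pauliZ3 tensmx1.
by case/mulmx1_unit.
Qed.

Local Notation p := (cubic_avg W).

Lemma three_neq0 : 3 != 0 :> C.
Proof. by rewrite pnatr_eq0. Qed.

Lemma h_TL_add1_neq0 : h_TL R + 1 != 0.
Proof. by rewrite h_TLE addrC subr_eq0 eq_sym omega_neq1. Qed.

Lemma twisted_avg_idem : p *m p = p.
Proof. exact: cubic_avg_idem three_neq0 twistedU3. Qed.

Lemma conj_U : ZZ R *m U R *m invmx (ZZ R) = W.
Proof. by rewrite ZZ_U mulmxK ?ZZ_unit. Qed.

Lemma R1E : R1 R = (Num.sqrt 3 : R)^-1%:C%C *: (1%:M + w ^+ 2 *: (W + W *m W)).
Proof.
have U2 : ZZ R *m (U R ^+ 2) *m invmx (ZZ R) = W *m W.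
  rewrite expr2 -[U R * U R]/(U R *m U R) -conj_U.
  by rewrite !mulmxA mulmxKV ?ZZ_unit.
rewrite /R1 -scalemxAr -scalemxAl mulmxDr mulmxDl mulmx1 mulmxV ?ZZ_unit //.
by rewrite -scalemxAr -scalemxAl mulmxDr mulmxDl conj_U U2.
Qed.

(** Coefficients are compared: with -i / sqrt 3 = -(w - w^2) / 3, the identity gets -w - (1 - w) / 3
    and both W and W^2 get -(1 - w) / 3 on either side. *)
Lemma R1tE : R1t R = idem_gen (h_TL R) p.
Proof.
have s0 : (Num.sqrt 3 : R)%:C%C != 0 :> C.
  by rewrite fmorph_eq0 sqrtr_eq0 -ltNge ltr0n.
have ss : (Num.sqrt 3 : R)%:C%C * (Num.sqrt 3 : R)%:C%C = 3 :> C.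
  by rewrite -rmorphM -expr2 sqr_sqrtr ?ler0n // rmorph_nat.
have coef : - 'i%C * (Num.sqrt 3 : R)^-1%:C%C = - (w - w * w) / 3 :> C.
  apply: (mulIf s0); rewrite fmorphV mulfVK // -sqrt3i.
  by move: (_%:C%C) ss => s ss; field: ss.
rewrite /R1t R1E /idem_gen h_TLE scalerA coef /cubic_avg.
have w2 : w * w = - 1 - w.
  by apply/eqP; rewrite -subr_eq0 -(omega_sum R); apply/eqP; ring.
move: (W *m W) W => WW V.
by apply/matrixP => i j; rewrite !mxE; field: w2.
Qed.

End Pauli.

(** * Unitarity from orthogonal projections *)

Section UnitaryIdem.
Variables (C : numClosedFieldType) (N : nat).

(** A self-adjoint idempotent has orthogonal image and kernel, on which the generator acts by the
    unit scalars -1 and q. *)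
Lemma unitary_idem_gen (q : C) (e : 'M[C]_N) :
  q * q^* = 1 -> e *m e = e -> map_mx Num.conj e^T = e ->
  idem_gen q e \is unitarymx.
Proof.
move=> qq ee e_adj; apply/unitarymxP.
rewrite /idem_gen linearB /= [(_ *: e)^T]linearZ /= tr_scalar_mx.
rewrite map_mxB map_mxZ map_scalar_mx /= e_adj.
rewrite rmorphD rmorph1 /= mulmxBl !mulmxBr -!scalemxAl -!scalemxAr ee.
rewrite !mul_scalar_mx mul_mx_scalar scale_scalar_mx qq.
by apply/matrixP => i j; rewrite !mxE; ring: qq.
Qed.

(** Taking adjoints exchanges W and W^2. *)
Lemma cubic_avg_adj (W : 'M[C]_N) : W *m W *m W = 1%:M ->
  map_mx Num.conj W^T = W *m W -> map_mx Num.conj (cubic_avg W)^T = cubic_avg W.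
Proof.
move=> W3 Wadj; rewrite [(_ *: _)^T]linearZ /= [(_ + _)^T]linearD /=.
rewrite [(_ + _)^T]linearD /= trmx_mul trmx1.
rewrite map_mxZ !map_mxD map_mx1 map_mxM /= Wadj mulmxA W3 mul1mx.
by rewrite addrAC fmorphV rmorph_nat.
Qed.

End UnitaryIdem.

(** * Local copies of averages and of Hecke generators *)

Section LocalCopyIdem.
Variables (C : numClosedFieldType) (d n : nat) (i : 'I_n.-1).
Implicit Types A B : 'M[C]_(d * d).

Lemma local_copy_idem_gen q A :
  local_copy (idem_gen q A) i = idem_gen q (local_copy A i).
Proof.
rewrite /idem_gen -[q%:M in LHS]scalemx1 local_copyD local_copyN !local_copyZ.
by rewrite local_copy1 scalemx1.
Qed.

Lemma local_copy_cubic_avg A :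
  local_copy (cubic_avg A) i = cubic_avg (local_copy A i).
Proof. by rewrite local_copyZ !local_copyD local_copyM local_copy1. Qed.

End LocalCopyIdem.

(** * Temperley-Lieb representation, rank and spectrum of the qutrit operator *)

Section Localization.
Variable R : realType.
Local Notation C := R[i].
Local Notation w := (omega R).
Local Notation h := (h_TL R).
Local Notation Rt := (R1t R).
Local Notation W := (twistedU R).
Local Notation p := (cubic_avg W).

Lemma tl_parameter : h / (1 + h) ^+ 2 = 1 / 3.
Proof.
have w0 : w != 0 := expi_neq0 _.
(* With h = -w this is (1 - w)^2 = -3 w, again by 1 + w + w^2 = 0. *)
have -> : (1 + h) ^+ 2 = 3 * h.
  rewrite h_TLE; apply/eqP; rewrite -subr_eq0 -(omega_sum R).
  by apply/eqP; ring.
by rewrite h_TLE; field; exact: w0.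
Qed.

Section Generators.
Variable n : nat.
Implicit Types i j : 'I_n.-1.
Local Notation Wi i := (local_copy W i).

Lemma local_twistedU3 i : Wi i *m Wi i *m Wi i = 1%:M.
Proof. by rewrite -!local_copyM twistedU3 local_copy1. Qed.

(** At the shared site the factor w Z of the right copy meets the X of the left one. *)
Lemma local_twistedU_comm i j :
  j = i.+1 :> nat -> Wi j *m Wi i = w *: (Wi i *m Wi j).
Proof.
move=> ij; apply: local_copy_adjacent => //.
by rewrite -scalemxAl -scalemxAr pauliZX.
Qed.

Lemma local_avg_tl i j : j = i.+1 :> nat \/ i = j.+1 :> nat ->
  local_copy p i *m local_copy p j *m local_copy p i =
  (h / (1 + h) ^+ 2) *: local_copy p i.
Proof.
rewrite tl_parameter div1r !local_copy_cubic_avg.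
have w1 := omega_neq1 R; have w2 := omega2_neq1 R; have w3 := omega3 R.
case=> ij.
  apply: cubic_avg_sandwich (local_twistedU_comm ij) => //.
    exact: three_neq0.
  exact: local_twistedU3.
(* With the sites in reverse order the commutation factor is the inverse of w, namely w^2, whose
   square is w. *)
apply: (@cubic_avg_sandwich _ _ _ _ (w * w)) => //.
- exact: three_neq0.
- exact: local_twistedU3.
- by rewrite mulrA w3 mul1r.
- by rewrite (local_twistedU_comm ij) scalerA w3 scale1r.
Qed.

Lemma local_avg_idem i : local_copy p i *m local_copy p i = local_copy p i.
Proof. by rewrite -local_copyM twisted_avg_idem. Qed.

Lemma local_R1t i : local_copy Rt i = idem_gen h (local_copy p i).
Proof. by rewrite R1tE local_copy_idem_gen. Qed.

Lemma local_R1t_braid i j : j = i.+1 :> nat ->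
  local_copy Rt i *m local_copy Rt j *m local_copy Rt i =
  local_copy Rt j *m local_copy Rt i *m local_copy Rt j.
Proof.
move=> ij; rewrite !local_R1t; apply: idem_gen_braid.
- exact: h_TL_add1_neq0.
- exact: local_avg_idem.
- exact: local_avg_idem.
- by apply: local_avg_tl; left.
- by apply: local_avg_tl; right.
Qed.

Lemma tl_representation : exists rho : {lrmorphism tl n h -> 'M[C]_(3 ^ n)},
  forall i, rho (tl_gen i) = local_copy Rt i.
Proof.
have eE i : (h + 1)^-1 *: (h%:M - local_copy Rt i) = local_copy p i.
  by rewrite local_R1t idem_genK ?h_TL_add1_neq0.
apply: tl_lift_mx => [|i|i j ij|i j ij|i j ij].
- by rewrite expn_gt0.
- by rewrite local_R1t; apply: idem_gen_quadratic; apply: local_avg_idem.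
- exact: local_R1t_braid.
- exact: local_copy_far.
- by rewrite /= (eE i) (eE j); apply: local_avg_tl.
Qed.

End Generators.

(** The trace is 9 / 3, and characteristic zero lets the rank be read off from it. *)
Lemma twisted_avg_rank : \rank p = 3.
Proof.
apply/eqP; rewrite -(eqr_nat C) mxrank_idem_trace ?twisted_avg_idem //.
have ZW := ZZ_twistedU R.
rewrite (mxtrace_cubic_avg (ZZ_unit R) _ _ ZW) ?omega_neq1 ?omega2_neq1 //.
by rewrite (natrM _ 3 3) mulfK ?three_neq0.
Qed.

Lemma R1t_unitary : Rt \is unitarymx.
Proof.
rewrite R1tE; apply: unitary_idem_gen (twisted_avg_idem R) _.
  exact: expi_mul_conj.
by apply: cubic_avg_adj; rewrite ?twistedU3 ?twistedU_adj.
Qed.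

Lemma R1t_unitary_yang_baxter : unitary_yang_baxter Rt.
(* The Yang-Baxter equation is the braid relation for n = 3, where [ord_max] is the successor of
   [ord0]. *)
Proof. by split; [exact: R1t_unitary | exact: local_R1t_braid]. Qed.

Lemma R1t_quadratic : (Rt + 1%:M) *m (Rt - h%:M) = 0.
Proof. by rewrite R1tE; apply: idem_gen_quadratic; apply: twisted_avg_idem. Qed.

Lemma R1t_two_eigenvalues : two_eigenvalues Rt.
Proof.
exists (-1), h; split.
  by rewrite eq_sym -subr_eq0 opprK h_TL_add1_neq0.
move=> c; rewrite R1tE; apply: eigenvalue_idem_gen.
- exact: twisted_avg_idem.
- by rewrite -mxrank_eq0 twisted_avg_rank.
- by apply/eqP => p1; have := twisted_avg_rank; rewrite p1 mxrank1.
Qed.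

Lemma gaussian_sum : \sum_(a < 3) w ^+ (2 * a ^ 2) *: U R ^+ a =
  1%:M + w ^+ 2 *: (U R + U R ^+ 2).
Proof.
rewrite !big_ord_recl big_ord0 /= /bump /= !expr0 expr1 scale1r addr0 scalerDr.
(* The exponent is 8, congruent to 2 modulo 3. *)
have -> : w ^+ (2 * (1 + 1) ^ 2) = w ^+ 2.
  by have w3 := omega3 R; ring: w3.
by [].
Qed.

End Localization.

(** * Hecke type, spectral density, factorization and localization together *)

Unset Implicit Arguments.
Set Strict Implicit.

Theorem corollary12p5 (R : realType) :
  let h := h_TL R in
  let Rt := R1t R in
  [/\ (Rt + 1%:M) *m (Rt - h%:M) = 0,
      hecke_type h Rt /\ spectral_density h Rt = 1 / 3,
      forall n, (2 <= n)%N ->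
        exists rho : {lrmorphism hecke n h -> 'M[R[i]]_(3 ^ n)},
          (forall i, rho (hecke_gen i) = local_copy Rt i) /\
          exists rhobar : {lrmorphism tl n h -> 'M[R[i]]_(3 ^ n)},
            forall x, rho x = rhobar (tl_proj x)
    & [/\ R1 R = ZZ R *m ((Num.sqrt 3 : R)^-1%:C%C *:
                (\sum_(a < 3) omega R ^+ (2 * a ^ 2) *: U R ^+ a))
               *m invmx (ZZ R),
          h / (1 + h) ^+ 2 = 1 / 3
        & localizes Rt (fun n => tl n h) (fun n i => tl_gen i)]].
Proof.
move=> h Rt; split; first exact: R1t_quadratic.
- split.
    split; [exact: R1t_unitary_yang_baxter | exact: R1t_two_eigenvalues | |].
      exact: R1t_quadratic.
    by rewrite -addr_eq0 h_TL_add1_neq0.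
  rewrite /spectral_density /spectral_proj /Rt R1tE idem_genK ?h_TL_add1_neq0 //.
  by rewrite twisted_avg_rank.
- move=> n _; have [rhobar rhobarE] := tl_representation R n.
  (* The Hecke representation is taken as the pullback of the Temperley-Lieb one, so it factors by
     construction. *)
  exists (rhobar \o @tl_proj _ n h); split=> [i|]; first exact: rhobarE.
  by exists rhobar.
split.
- by rewrite gaussian_sum.
- exact: tl_parameter.
- split; first exact: R1t_unitary_yang_baxter.
  by move=> n _; apply: tl_representation.
Qed.
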